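(* Let $G$ and $H$ be finite connected graphs with $W(G)\geq E_1(G)$, $W(H)\geq E_1(H)$, and $\max\{n(G),n(H)\}>2$. Then $W(G\,\square\,H)>E_1(G\,\square\,H)$.
   Context: $G\,\square\,H$ is the Cartesian product: vertex set $V(G)\times V(H)$, with $(g,h)$ adjacent to $(g',h')$ iff either $gg'\in E(G)$ and $h=h'$, or $g=g'$ and $hh'\in E(H)$. $n(X)$ is the order of $X$, $\varepsilon_X(v)=\max_u d_X(v,u)$, $E_1(X)=\sum_v\varepsilon_X(v)^2$, and $W(X)=\sum_{\{u,v\}\subseteq V(X)}d_X(u,v)$ is the Wiener index.
   Formalization: The formal theorem also assumes that G and H each have at least two vertices; without this the claim fails for G = K_1, H = K_3, where the product is K_3 and W = E_1 = 3. *)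

(* Defs.v *)
From mathcomp Require Import all_boot.

Set Implicit Arguments.
Unset Strict Implicit.
Unset Printing Implicit Defensive.

Record sgraph := SGraph {
  vertex :> finType;
  adj : rel vertex;
  adj_sym : symmetric adj;
  adj_irr : irreflexive adj }.

Section Invariants.
Variable G : sgraph.

Definition n_vert : nat := #|{: G}|.

Definition is_connected : Prop :=
  0 < n_vert /\ forall x y : G, connect (@adj G) x y.

Definition has_walk (k : nat) (x y : G) : bool :=
  [exists p : k.-tuple G, path (@adj G) x p && (last x p == y)].

(* A shortest walk repeats no vertex, so lengths below the order suffice; the
   default value [n_vert] is reached only when x and y are not connected. *)
Definition dist (x y : G) : nat :=
  \big[minn/n_vert]_(k < n_vert | has_walk k x y) k.

Definition ecc (v : G) : nat := \max_(u : G) dist v u.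

Definition E1 : nat := \sum_(v : G) ecc v ^ 2.

(* Comparing ranks selects each unordered pair of distinct vertices once. *)
Definition wiener : nat :=
  \sum_(p : G * G | enum_rank p.1 < enum_rank p.2) dist p.1 p.2.

End Invariants.

Section CartesianProduct.
Variables G H : sgraph.

Definition cart_adj : rel (G * H) := fun p q =>
  adj p.1 q.1 && (p.2 == q.2) || (p.1 == q.1) && adj p.2 q.2.

Lemma cart_adj_sym : symmetric cart_adj.
Proof.
by move=> p q; rewrite /cart_adj adj_sym [adj p.2 _]adj_sym !(eq_sym q.1, eq_sym q.2).
Qed.

Lemma cart_adj_irr : irreflexive cart_adj.
Proof. by move=> p; rewrite /cart_adj !adj_irr andbF. Qed.

Definition cart_prod : sgraph := SGraph cart_adj_sym cart_adj_irr.

End CartesianProduct.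

Notation "G □ H" := (cart_prod G H) (at level 40, left associativity).

(* Main.v *)
(** Distances in [G □ H] are sums of distances, so with n = n(G), m = n(H) one
    has W(G □ H) = m^2 W(G) + n^2 W(H), and eccentricities are (sub)additive.
    From (a + b)^2 <= 2 (a^2 + b^2) one gets E1(G □ H) <= 2m E1(G) + 2n E1(H).
    Since W >= E1 > 0 on both factors and m, n >= 2 with one of them larger
    than 2, W(G □ H) >= m^2 E1(G) + n^2 E1(H) > 2m E1(G) + 2n E1(H). *)
Require Import Defs.
From mathcomp Require Import all_boot.

Set Implicit Arguments.
Unset Strict Implicit.
Unset Printing Implicit Defensive.

(** * Minima over a finite range with a default value *)

Lemma bigmin_leq (I : finType) (P : pred I) (F : I -> nat) (m : nat) (i : I) :
  P i -> \big[minn/m]_(k | P k) F k <= F i.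
Proof.
(* The default [m] is not neutral for [minn], so the term at [i] is located by induction on the
   enumeration. *)
move=> Pi; elim: (index_enum I) (mem_index_enum i) => // j r IHr.
rewrite inE big_cons => /predU1P[<- | /IHr le_r]; first by rewrite Pi geq_minl.
by case: ifP => // _; apply: leq_trans (geq_minr _ _) le_r.
Qed.

Lemma bigmin_mem (I : finType) (P : pred I) (F : I -> nat) (m : nat) (i : I) :
  P i -> F i < m -> exists2 j, P j & \big[minn/m]_(k | P k) F k = F j.
Proof.
move=> Pi lt_im; have := leq_ltn_trans (bigmin_leq F m Pi) lt_im.
(* The property carried along is that a value below [m] is attained; it is vacuous at the default
   [m] itself. *)
elim/big_ind: _ => [|a b IHa IHb|j Pj _]; first by rewrite ltnn.
- by rewrite /minn; case: ifP => _; [exact: IHa | exact: IHb].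
- by exists j.
Qed.

(** * Walks and distances in a single graph *)

Section Distance.
Variable G : sgraph.
Implicit Types x y z : G.

Lemma has_walkP k x y :
  reflect (exists p : seq G, [/\ size p = k, path (@adj G) x p & last x p = y])
          (has_walk k x y).
Proof.
apply: (iffP existsP) => [[p /andP[walk_p /eqP last_p]] | [p [<- walk_p last_p]]].
- by exists p; rewrite size_tuple.
- by exists (in_tuple p); rewrite walk_p last_p /=.
Qed.

Lemma has_walk0 x y : has_walk 0 x y = (x == y).
Proof.
apply/has_walkP/eqP => [[p [/size0nil-> _ <-]] // | <-].
by exists [::].
Qed.

Lemma has_walkS k x y z : adj x y -> has_walk k y z -> has_walk k.+1 x z.
Proof.
move=> xy /has_walkP[p [<- walk_p last_p]].
by apply/has_walkP; exists (y :: p); rewrite /= xy.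
Qed.

Lemma has_walk_cat k l x y z :
  has_walk k x y -> has_walk l y z -> has_walk (k + l) x z.
Proof.
move=> /has_walkP[p [<- walk_p last_p]] /has_walkP[q [<- walk_q last_q]].
by apply/has_walkP; exists (p ++ q); rewrite size_cat cat_path last_cat last_p walk_p.
Qed.

Lemma has_walk_sym k x y : has_walk k x y -> has_walk k y x.
Proof.
elim: k x => [|k IHk] x; first by rewrite !has_walk0 eq_sym.
case/has_walkP=> [[|z p] [] //= [size_p] /andP[xz walk_p] last_p].
rewrite -addn1; apply: (@has_walk_cat _ _ _ z).
- by apply: IHk; apply/has_walkP; exists p.
- by apply: (has_walkS (y := x)); rewrite ?has_walk0 // adj_sym.
Qed.

Lemma has_walk_connect k x y : has_walk k x y -> connect (@adj G) x y.
Proof. by case/has_walkP=> p [_ walk_p last_p]; apply/connectP; exists p. Qed.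

(** Shortening a path until no vertex repeats brings its length below the order, so the minimum in
    [dist] is attained by a walk and is not the default. *)
Lemma dist_has_walk x y : connect (@adj G) x y -> has_walk (dist x y) x y.
Proof.
case/connectP=> p walk_p ->; case/shortenP: walk_p => q walk_q uniq_q _.
have lt_q : size q < n_vert G.
  by rewrite -[_.+1]/(size (x :: q)) -(card_uniqP uniq_q) max_card.
have walk : has_walk (Ordinal lt_q) x (last x q) by apply/has_walkP; exists q.
have [j walk_j] := bigmin_mem (P := fun k : 'I__ => has_walk k x (last x q))
  (F := @nat_of_ord (n_vert G)) (i := Ordinal lt_q) walk lt_q.
by rewrite /dist => ->.
Qed.

Lemma dist_leq k x y : has_walk k x y -> dist x y <= k.
Proof.
move=> walk; case: (ltnP k (n_vert G)) => [lt_k | le_k].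
- exact: (bigmin_leq (P := fun k : 'I__ => has_walk k x y)
            (@nat_of_ord _) _ (i := Ordinal lt_k)).
- apply: leq_trans le_k; rewrite /dist; elim/big_ind: _ => //= [a b le_a _|i _].
  + exact: leq_trans (geq_minl _ _) le_a.
  + exact: ltnW.
Qed.

Lemma dist_self x : dist x x = 0.
Proof. by apply/eqP; rewrite -leqn0 dist_leq // has_walk0. Qed.

Hypothesis conG : is_connected G.

Lemma dist_walk x y : has_walk (dist x y) x y.
Proof. exact: dist_has_walk (conG.2 x y). Qed.

Lemma dist_sym x y : dist x y = dist y x.
Proof. by apply/eqP; rewrite eqn_leq !dist_leq // has_walk_sym // dist_walk. Qed.

Lemma dist_eq0 x y : (dist x y == 0) = (x == y).
Proof.
apply/eqP/eqP => [d0 | ->]; last exact: dist_self.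
by apply/eqP; rewrite -has_walk0 -d0 dist_walk.
Qed.

(** Ordered pairs split by rank into increasing, decreasing and diagonal ones. The diagonal
    contributes 0, and swapping coordinates matches the first two. Sums over all ordered pairs
    factor over a product, unlike the rank-restricted sum. *)
Lemma double_wiener : (wiener G).*2 = \sum_(x : G) \sum_(y : G) dist x y.
Proof.
rewrite pair_big /= (bigID (fun p : G * G => enum_rank p.1 < enum_rank p.2)) /=.
rewrite -addnn; congr (_ + _).
rewrite (bigID (fun p : G * G => enum_rank p.2 < enum_rank p.1)) /=.
rewrite [X in _ = _ + X]big1 ?addn0 => [|[x y] /=]; last first.
  rewrite -!leqNgt -eqn_leq => /eqP eq_rank; apply/eqP.
  by rewrite dist_eq0 -(inj_eq enum_rank_inj); apply/eqP/val_inj.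
have swapK : involutive (fun p : G * G => (p.2, p.1)) by case.
rewrite /wiener (reindex_inj (inv_inj swapK)) /=.
apply: eq_big => [[x y] | [x y] _] /=; last exact: dist_sym.
by case: ltngtP.
Qed.

Lemma dist_leq_ecc x y : dist x y <= ecc x.
Proof. exact: (leq_bigmax (F := dist x)). Qed.

Lemma E1_gt0 : 1 < n_vert G -> 0 < E1 G.
Proof.
case/card_gt1P=> x [y [_ _ neq_xy]].
rewrite /E1 (bigD1 x) //= ltn_addr // expn_gt0 (leq_trans _ (dist_leq_ecc x y)) //.
by rewrite lt0n dist_eq0.
Qed.

End Distance.

(** * Distances and both invariants in the Cartesian product *)

Section Product.
Variables G H : sgraph.

Lemma has_walk_prodl k (x y : G) (h : H) :
  has_walk k x y -> has_walk (G := G □ H) k (x, h) (y, h).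
Proof.
elim: k x => [|k IHk] x; first by rewrite !has_walk0 => /eqP ->.
case/has_walkP=> [[|z p] [] //= [size_p] /andP[xz walk_p] last_p].
apply: (has_walkS (G := G □ H) (y := (z, h))); first by rewrite /= /cart_adj /= xz eqxx.
by apply: IHk; apply/has_walkP; exists p.
Qed.

Lemma has_walk_prodr k (g : G) (x y : H) :
  has_walk k x y -> has_walk (G := G □ H) k (g, x) (g, y).
Proof.
elim: k x => [|k IHk] x; first by rewrite !has_walk0 => /eqP ->.
case/has_walkP=> [[|z p] [] //= [size_p] /andP[xz walk_p] last_p].
apply: (has_walkS (G := G □ H) (y := (g, z))); first by rewrite /= /cart_adj /= xz eqxx orbT.
by apply: IHk; apply/has_walkP; exists p.
Qed.

(** Every edge of the product moves exactly one coordinate, so each step is charged to one of the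
    two projected walks. This gives the lower bound in [dist_prod]. *)
Lemma has_walk_split k (p q : G □ H) :
  has_walk k p q ->
  exists i j, [/\ i + j = k, has_walk i p.1 q.1 & has_walk j p.2 q.2].
Proof.
elim: k p => [|k IHk] p.
  by rewrite has_walk0 => /eqP ->; exists 0, 0; rewrite !has_walk0 !eqxx.
case/has_walkP=> [[|r s] [] //= [size_s] /andP[pr walk_s] last_s].
have [|i [j [eq_k walk_i walk_j]]] := IHk r; first by apply/has_walkP; exists s.
case/orP: pr => /andP[].
- move=> pr /eqP ->; exists i.+1, j; rewrite addSn eq_k; split=> //.
  exact: has_walkS walk_i.
- move=> /eqP -> pr; exists i, j.+1; rewrite addnS eq_k; split=> //.
  exact: has_walkS walk_j.
Qed.

Hypotheses (conG : is_connected G) (conH : is_connected H).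

Lemma has_walk_prod (p q : G □ H) :
  has_walk (dist p.1 q.1 + dist p.2 q.2) p q.
Proof.
case: p q => [x1 x2] [y1 y2] /=.
apply: (has_walk_cat (G := G □ H) (y := (y1, x2))).
- by apply: has_walk_prodl; apply: dist_walk.
- by apply: has_walk_prodr; apply: dist_walk.
Qed.

Lemma cart_prod_connected : is_connected (G □ H).
Proof.
split=> [|p q]; last exact: has_walk_connect (has_walk_prod p q).
by rewrite /n_vert card_prod muln_gt0 conG.1 conH.1.
Qed.

Lemma dist_prod (p q : G □ H) : dist p q = dist p.1 q.1 + dist p.2 q.2.
Proof.
apply/eqP; rewrite eqn_leq dist_leq ?has_walk_prod //=.
have [i [j [<- walk_i walk_j]]] :=
  has_walk_split (dist_walk cart_prod_connected p q).
by rewrite leq_add // dist_leq.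
Qed.

Lemma ecc_prod_leq (p : G □ H) : ecc p <= ecc p.1 + ecc p.2.
Proof.
by apply/bigmax_leqP => q _; rewrite dist_prod leq_add // dist_leq_ecc.
Qed.

(** In the sum over ordered pairs, each distance in [G] recurs once for every ordered pair of
    vertices of [H], and conversely. *)
Lemma wiener_prod :
  wiener (G □ H) = n_vert H ^ 2 * wiener G + n_vert G ^ 2 * wiener H.
Proof.
apply: double_inj; rewrite doubleD !doubleMr !double_wiener //; last first.
  exact: cart_prod_connected.
transitivity (\sum_(x : G) \sum_(x' : H) \sum_(y : G) \sum_(y' : H)
                (dist x y + dist x' y')).
  rewrite [RHS]pair_big; apply: eq_bigr => -[x x'] _.
  by rewrite [RHS]pair_big; apply: eq_bigr => -[y y'] _; rewrite dist_prod.
have inner (x : G) (x' : H) :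
    \sum_(y : G) \sum_(y' : H) (dist x y + dist x' y') =
    n_vert H * \sum_(y : G) dist x y + n_vert G * \sum_(y' : H) dist x' y'.
  under eq_bigr do rewrite big_split /= sum_nat_const.
  by rewrite big_split /= sum_nat_const -big_distrr.
under eq_bigr do under eq_bigr do rewrite inner.
under eq_bigr do rewrite big_split /= sum_nat_const -big_distrr /=.
rewrite big_split /= sum_nat_const -!big_distrr /=.
by rewrite -!mulnn !mulnA.
Qed.

Lemma E1_prod_leq :
  E1 (G □ H) <= 2 * (n_vert H * E1 G + n_vert G * E1 H).
Proof.
(* Each vertex of one factor has as many copies in the product as the other factor has vertices, so
   the bound can be checked vertex by vertex. *)
have -> : n_vert H * E1 G + n_vert G * E1 H =
          \sum_(p : G □ H) (ecc p.1 ^ 2 + ecc p.2 ^ 2).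
  rewrite -(pair_bigA _ (fun (x : G) (y : H) => ecc x ^ 2 + ecc y ^ 2)) /=.
  under [RHS]eq_bigr do rewrite big_split /= sum_nat_const.
  by rewrite big_split /= sum_nat_const -big_distrr.
rewrite big_distrr /=; apply: leq_sum => p _.
apply: (@leq_trans ((ecc p.1 + ecc p.2) ^ 2)).
  by rewrite leq_sqr ecc_prod_leq.
(* After cancelling the squares, 2ab <= a^2 + b^2 remains. *)
rewrite sqrnD [leqRHS]mul2n -addnn leq_add2l; exact: (nat_Cauchy (ecc p.1) (ecc p.2)).1.
Qed.

End Product.

(** [ntG] and [ntH] exclude one-vertex factors: K_1 □ K_3 is a copy of K_3, where W = E1 = 3, so
    strictness fails there. *)
Theorem theorem5p2 (G H : sgraph)
  (conG : is_connected G) (conH : is_connected H)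
  (ntG : 1 < n_vert G) (ntH : 1 < n_vert H)
  (WG : wiener G >= E1 G) (WH : wiener H >= E1 H)
  (n_gt2 : maxn (n_vert G) (n_vert H) > 2) :
  wiener (G □ H) > E1 (G □ H).
Proof.
apply: leq_ltn_trans (E1_prod_leq conG conH) _; rewrite wiener_prod //.
have E1G := E1_gt0 conG ntG; have E1H := E1_gt0 conH ntH.
apply: (@leq_trans (n_vert H ^ 2 * E1 G + n_vert G ^ 2 * E1 H)%N); last first.
  by rewrite leq_add // leq_mul2l ?WG ?WH orbT.
rewrite mulnDr !mulnA -!mulnn.
have le_H : 2 * n_vert H * E1 G <= n_vert H * n_vert H * E1 G.
  by rewrite !leq_mul2r ntH !orbT.
have le_G : 2 * n_vert G * E1 H <= n_vert G * n_vert G * E1 H.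
  by rewrite !leq_mul2r ntG !orbT.
(* The successor from the strict inequality goes to the summand whose order exceeds 2; positivity of
   the [E1] factor in it keeps that comparison strict. *)
move: n_gt2; rewrite leq_max => /orP[gt2 | gt2].
- rewrite -addnS leq_add // !ltn_mul2r E1H gt2 andbT /=; exact: ltnW (ltnW gt2).
- rewrite -addSn leq_add // !ltn_mul2r E1G gt2 andbT /=; exact: ltnW (ltnW gt2).
Qed.
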